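(* Let $\mathrm{st}$ be a descent statistic and let $S\subseteq\{(J,K)\in\mathcal{C}\times\mathcal{C} : J\sim_{\mathrm{st}}K\}$. Let $\mathcal{F}_S^{\mathrm{st}}=\{F_J-F_K : (J,K)\in S\}$ and let $G_S$ be the directed graph with vertex set $\mathcal{C}$ and edge set $S$. (a) The kernel $\mathcal{K}^{\mathrm{st}}$ is spanned (over $\mathbb{Q}$) by $\mathcal{F}_S^{\mathrm{st}}$ if and only if the connected components of $G_S$ are precisely the $\mathrm{st}$-equivalence classes of $\mathcal{C}$, i.e., for all $J,K\in\mathcal{C}$: $J\sim_{\mathrm{st}}K$ if and only if $J$ and $K$ are in the same connected component of $G_S$. (b) The set $\mathcal{F}_S^{\mathrm{st}}$ is linearly independent (over $\mathbb{Q}$) if and only if $G_S$ is a forest.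
   Context: A permutation of length $n$ is a word $\pi=\pi_1\cdots\pi_n$ of $n$ distinct positive integers. Its standardization is the permutation of $\{1,\dots,n\}$ obtained by replacing the $i$th smallest letter by $i$ for each $i$. A permutation statistic is a function on permutations taking equal values on permutations with the same standardization. The descent composition of $\pi$ is the composition whose parts are the lengths of the maximal increasing consecutive subsequences (increasing runs) of $\pi$, in order. $\mathcal{C}$ is the set of all compositions (finite sequences of positive integers, including the empty composition $\emptyset$ of $0$); $|L|$ is the sum of the parts of $L$. A descent statistic is a permutation statistic $\mathrm{st}$ such that $\mathrm{st}\,\pi=\mathrm{st}\,\sigma$ whenever $\pi$ and $\sigma$ have the same descent composition; then $\mathrm{st}\,L$ denotes the value of $\mathrm{st}$ on any permutation with descent composition $L$. Write $J\sim_{\mathrm{st}}K$ ($J$ and $K$ are $\mathrm{st}$-equivalent) if $\mathrm{st}\,J=\mathrm{st}\,K$ and $|J|=|K|$. For $L=(j_1,\dots,j_m)$ with $|L|=n$, let $\mathrm{Des}\,L=\{j_1,j_1+j_2,\dots,j_1+\cdots+j_{m-1}\}$, and let $F_L=\sum x_{i_1}x_{i_2}\cdots x_{i_n}$, summed over positive integers $i_1\le i_2\le\cdots\le i_n$ with $i_j<i_{j+1}$ whenever $j\in\mathrm{Des}\,L$ (fundamental quasisymmetric function). The $F_L$, $L\in\mathcal{C}$, form a basis of the $\mathbb{Q}$-algebra $\mathrm{QSym}$ of quasisymmetric functions. The kernel of $\mathrm{st}$ is $\mathcal{K}^{\mathrm{st}}=\mathrm{span}_{\mathbb{Q}}\{F_J-F_K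 : J\sim_{\mathrm{st}}K\}\subseteq\mathrm{QSym}$. A connected component of a directed graph means a connected component of its underlying undirected graph. A directed graph is a forest if its underlying undirected graph (a multigraph with one undirected edge per directed edge) has no cycles, where a loop counts as a cycle and the two edges arising from $(J,K)$ and $(K,J)$ with $J\neq K$ count as a cycle. *)

(* Defs.v *)
From HB Require Import structures.
From mathcomp Require Import all_boot all_order all_algebra.
From mathcomp Require Import finmap multiset.
From mathcomp Require Import boolp classical_sets functions cardinality fsbigop.

Set Implicit Arguments.
Unset Strict Implicit.
Unset Printing Implicit Defensive.

Import GRing.Theory.

Local Open Scope classical_set_scope.
Local Open Scope ring_scope.

(** * Compositions *)

Record composition := Composition {
  parts :> seq nat;
  _ : all (leq 1) parts }.

HB.instance Definition _ := [isSub for parts].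
HB.instance Definition _ := [Countable of composition by <:].

Definition weight (L : composition) : nat := sumn L.

Definition Des (L : composition) : seq nat :=
  [seq sumn (take i L) | i <- iota 1 (size L).-1].

(** * Permutations *)

Definition is_permutation (w : seq nat) : bool := uniq w && all (leq 1) w.

Record permutation := Permutation {
  letters :> seq nat;
  _ : is_permutation letters }.

HB.instance Definition _ := [isSub for letters].
HB.instance Definition _ := [Countable of permutation by <:].

Definition standardize (p : permutation) : seq nat :=
  [seq (index x (sort leq p)).+1 | x <- p].

(* The maximal increasing consecutive subsequences of [w], from left to right:
   a new first letter [x] either extends the first run of the remaining word
   (if it is smaller than the letter following it) or forms a run by itself. *)
Fixpoint runs (w : seq nat) : seq (seq nat) :=
  if w is x :: w' then
    if runs w' is (y :: r) :: rs then
      if (x < y)%N then (x :: y :: r) :: rs else [:: x] :: (y :: r) :: rs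
    else [:: [:: x]]
  else [::].

Lemma runs_size_gt0 w : all (leq 1) (map size (runs w)).
Proof.
elim: w => [|x w] //=.
by case: (runs w) => [|[|y r] rs] //= H; case: ifP.
Qed.

Definition descent_comp (p : permutation) : composition :=
  Composition (runs_size_gt0 p).

(** * Statistics *)

Definition permutation_statistic (V : Type) (st : permutation -> V) : Prop :=
  forall p q, standardize p = standardize q -> st p = st q.

Definition descent_statistic (V : Type) (st : permutation -> V) : Prop :=
  permutation_statistic st /\
  forall p q, descent_comp p = descent_comp q -> st p = st q.

Lemma runs_cons x w : runs (x :: w) =
  if runs w is (y :: r) :: rs then
    if (x < y)%N then (x :: y :: r) :: rs else [:: x] :: (y :: r) :: rs
  else [:: [:: x]].
Proof. by []. Qed.

Lemma runs_iota_cat a j w : all (fun x => x <= a)%N w ->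
  runs (iota a.+1 j.+1 ++ w) = iota a.+1 j.+1 :: runs w.
Proof.
move=> ha; have {ha}: all (fun x => x <= a.+1)%N w.
  by apply: sub_all ha => x /leqW.
elim: j a.+1 => [|j IHj] b hb.
  case: w hb => [|y w] //= /andP[hy _].
  have : exists r rs, (if runs w is (z :: r) :: rs then
      if (y < z)%N then (y :: z :: r) :: rs else [:: y] :: (z :: r) :: rs
      else [:: [:: y]]) = (y :: r) :: rs.
    by case: (runs w) => [|[|z r] rs]; [| |case: ifP]; eexists; eexists.
  by move=> [r [rs ->]]; rewrite ltnNge hy.
have -> : iota b j.+2 = b :: iota b.+1 j.+1 by [].
have /IHj e : all (fun x => x <= b.+1)%N w.
  by apply: sub_all hb => x /leqW.
by rewrite cat_cons runs_cons e /= ltnSn.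
Qed.

Lemma descent_comp_surj (L : composition) :
  exists p : permutation, descent_comp p == L.
Proof.
suff [w [hw _ eL]] : exists w, [/\ is_permutation w,
    all (fun x => x <= sumn L)%N w & map size (runs w) = L].
  by exists (Permutation hw); apply/eqP/val_inj.
case: L => L /=; elim: L => [|[|j] L IHL] //=.
  by move=> _; exists [::].
move=> /IHL [w [/andP[uw pw] bw eL]].
exists (iota (sumn L).+1 j.+1 ++ w); split.
- rewrite /is_permutation cat_uniq iota_uniq uw all_cat pw /= !andbT.
  apply/andP; split.
    apply/hasPn => x /(allP bw) xL; rewrite -[_ :: _]/(iota (sumn L).+1 j.+1).
    by rewrite mem_iota ltnNge xL.
  by apply/allP => x; rewrite mem_iota => /andP[/(leq_trans _) -> //].
- rewrite all_cat; apply/andP; split.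
    apply/allP => x; rewrite mem_iota => /andP[_].
    by rewrite addSn ltnS addnC.
  by apply: sub_all bw => x /leq_trans -> //; rewrite leq_addl.
- by rewrite runs_iota_cat //= size_iota eL.
Qed.

(* [st L]: the value of [st] on some permutation with descent composition [L];
   for a descent statistic, it is its value on all of them, see
   [stat_comp_descent]. *)
Definition stat_comp (V : Type) (st : permutation -> V) (L : composition) : V :=
  st (xchoose (descent_comp_surj L)).

Lemma stat_comp_descent (V : Type) (st : permutation -> V) (p : permutation) :
  descent_statistic st -> stat_comp st (descent_comp p) = st p.
Proof. by move=> [_]; apply; apply/eqP/(xchooseP (descent_comp_surj _)). Qed.

Definition st_equiv (V : Type) (st : permutation -> V) (J K : composition) :
  Prop := stat_comp st J = stat_comp st K /\ weight J = weight K.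

(** * Linear algebra in arbitrary dimension *)

Definition linear_span (F : fieldType) (E : lmodType F) (A : set E) : set E :=
  [set v | exists (n : nat) (c : 'I_n -> F) (u : 'I_n -> E),
     (forall i, A (u i)) /\ v = \sum_(i < n) c i *: u i].

(* Independence of the set [A] (not of a family): the vectors of a vanishing
   combination are required to be distinct. *)
Definition linearly_independent (F : fieldType) (E : lmodType F) (A : set E) :
  Prop :=
  forall (n : nat) (c : 'I_n -> F) (u : 'I_n -> E),
    injective u -> (forall i, A (u i)) ->
    \sum_(i < n) c i *: u i = 0 -> forall i, c i = 0.

(** * Fundamental quasisymmetric functions *)

(* Formal power series over the rationals, given by their coefficients; a
   monomial in the variables x_i is the multiset of its indices. Only the
   variables x_i with i positive occur below. Since spans and linear
   independence are the same in QSym and in this space, QSym is not singled out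
   as a subspace. *)
Definition power_series : lmodType rat := ({mset nat}%mset -> rat^o).

(* The words i_1 ... i_n (n = |L|) indexing the sum that defines F_L; positions
   are numbered from 0 by [nth], whereas those in [Des L] start from 1. *)
Definition fundamental_word (L : composition) (w : seq nat) : bool :=
  [&& size w == weight L, all (leq 1) w, sorted leq w &
      all (fun j => nth 0%N w j.-1 < nth 0%N w j)%N (Des L)].

(* [seq_mset w] is the monomial x_{i_1} ... x_{i_n}. The sum is taken
   coefficientwise; each has at most one nonzero term, as a monomial comes from
   at most one weakly increasing word. *)
Definition fundamental (L : composition) : power_series :=
  fun m => \sum_(w \in [set w | fundamental_word L w]) ((m == seq_mset w)%:R : rat).

Definition fundamental_differences (S : set (composition * composition)) :
  set power_series :=
  [set fundamental e.1 - fundamental e.2 | e in S].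

Definition kernel (V : Type) (st : permutation -> V) : set power_series :=
  linear_span (fundamental_differences [set e | st_equiv st e.1 e.2]).

(** * Directed graphs on a vertex type, given by their set of edges *)

(* A step of a walk in the underlying undirected multigraph: an edge, traversed
   forwards ([true]) or backwards ([false]). The undirected edges are named by
   the directed ones, so that (x, y) and (y, x) are different edges. *)
Definition step (T : eqType) := ((T * T) * bool)%type.

Definition step_source (T : eqType) (s : step T) : T :=
  if s.2 then s.1.1 else s.1.2.

Definition step_target (T : eqType) (s : step T) : T :=
  if s.2 then s.1.2 else s.1.1.

Fixpoint walk (T : eqType) (S : set (T * T)) (x : T) (p : seq (step T)) (y : T) :
  Prop :=
  if p is s :: p' then
    [/\ S s.1, step_source s = x & walk S (step_target s) p' y]
  else x = y.

Definition same_component (T : eqType) (S : set (T * T)) (x y : T) : Prop :=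
  exists p, walk S x p y.

(* Length 1 gives the loops, length 2 the pairs of parallel edges. *)
Definition is_cycle (T : eqType) (S : set (T * T)) (p : seq (step T)) : Prop :=
  [/\ p <> [::], exists x, walk S x p x, uniq (map (@step_source T) p) &
      uniq (map fst p)].

Definition forest (T : eqType) (S : set (T * T)) : Prop :=
  forall p, ~ is_cycle S p.

(* Main.v *)
(* The monomial of the word that ascends exactly at Des K occurs in F_L only if
   |L| = |K| and Des L is contained in Des K. By triangularity the F_L are
   independent, so every function phi on compositions extends to a linear form
   sending F_L to phi L. Taking for phi the indicator of a component of the
   graph gives both nontrivial implications: it annihilates all F_J - F_K with
   (J, K) an edge, so a difference in their span joins two vertices of one
   component; and for the graph with one edge (J, K) removed, when that edge is
   a bridge, it annihilates every remaining difference but not F_J - F_K.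
   Conversely a cycle is a telescoping sum equal to 0. *)

Require Import Defs.
From mathcomp Require Import all_boot all_order all_algebra.
From mathcomp Require Import finmap multiset.
From mathcomp Require Import boolp classical_sets functions fsbigop.

Set Implicit Arguments.
Unset Strict Implicit.
Unset Printing Implicit Defensive.

Import GRing.Theory Num.Theory Order.TTheory.

Local Open Scope classical_set_scope.
Local Open Scope ring_scope.

(** * Linear spans *)

Section Span.
Variables (F : fieldType) (E : lmodType F).
Implicit Types A B : set E.

Lemma sub_linear_span A : A `<=` linear_span A.
Proof.
move=> v Av; exists 1%N, (fun=> 1), (fun=> v); split=> //.
by rewrite big_ord1 scale1r.
Qed.

Lemma linear_span0 A : linear_span A 0.
Proof. by exists 0%N, (fun=> 0), (fun=> 0); split=> [[]//|]; rewrite big_ord0. Qed.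

Lemma linear_spanZ A a v : linear_span A v -> linear_span A (a *: v).
Proof.
move=> [n [c [u [Au ->]]]]; exists n, (fun i => a * c i), u; split=> //.
by rewrite scaler_sumr; apply: eq_bigr => i _; rewrite scalerA.
Qed.

Lemma linear_spanD A v w :
  linear_span A v -> linear_span A w -> linear_span A (v + w).
Proof.
move=> [n [c [u [Au ->]]]] [m [d [t [At ->]]]].
pose glue T (f : 'I_n -> T) (g : 'I_m -> T) (i : 'I_(n + m)) :=
  match fintype.split i with inl j => f j | inr k => g k end.
exists (n + m)%N, (glue _ c d), (glue _ u t); split=> [i|].
  by rewrite /glue; case: (fintype.split i).
rewrite big_split_ord /glue; congr (_ + _); apply: eq_bigr => i _.
  by rewrite -[lshift _ _]/(unsplit (inl i)) unsplitK.
by rewrite -[rshift _ _]/(unsplit (inr i)) unsplitK.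
Qed.

Lemma linear_span_min A B :
  A `<=` linear_span B -> linear_span A `<=` linear_span B.
Proof.
move=> AB _ [n [c [u [Au ->]]]].
elim/big_ind: _ => [|v w|i _]; first exact: linear_span0.
  exact: linear_spanD.
exact/linear_spanZ/AB.
Qed.

End Span.

(** * Walks, components and bridges *)

Section Walks.
Variable T : eqType.
Implicit Types (S : set (T * T)) (x y z : T) (p q : seq (step T)).

Lemma walk_cat S x p y q z : walk S x p y -> walk S y q z -> walk S x (p ++ q) z.
Proof.
elim: p x => [|s p IHp] x /=; first by move=> ->.
by move=> [Ss sx /IHp wp] /wp.
Qed.

Lemma walk_sub S S' x p y : S `<=` S' -> walk S x p y -> walk S' x p y.
Proof.
move=> SS'; elim: p x => [|s p IHp] x //= [Ss sx /IHp wp].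
by split=> //; apply: SS'.
Qed.

Lemma same_component_refl S x : same_component S x x.
Proof. by exists [::]. Qed.

Lemma same_component_trans S x y z :
  same_component S x y -> same_component S y z -> same_component S x z.
Proof. by move=> [p wp] [q wq]; exists (p ++ q); apply: walk_cat wp wq. Qed.

Lemma same_component_edge S x y : S (x, y) -> same_component S x y.
Proof. by move=> Sxy; exists [:: ((x, y), true)]. Qed.

Lemma same_component_edgeC S x y : S (x, y) -> same_component S y x.
Proof. by move=> Sxy; exists [:: ((x, y), false)]. Qed.

Lemma component_edge S x y z :
  S (y, z) -> same_component S x y <-> same_component S x z.
Proof.
move=> Syz; split=> /same_component_trans; apply.
  exact: same_component_edge.
exact: same_component_edgeC.
Qed.

(** [walk_shorten] gives distinct targets while [is_cycle] asks for distinct sources; this passes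
    from one list of vertices to the other. *)
Lemma walk_sources S x p y : walk S x p y ->
  rcons (map (@step_source T) p) y = x :: map (@step_target T) p.
Proof.
elim: p x => [|s p IHp] x /=; first by move=> ->.
by move=> [_ -> /IHp ->].
Qed.

Lemma walk_edges S x p y : walk S x p y -> forall s, s \in p -> S s.1.
Proof.
elim: p x => [|t p IHp] x //= [St _ /IHp Sp] s.
by rewrite inE => /orP[/eqP ->//|/Sp].
Qed.

Lemma walk_suffix S x p y z : walk S x p y -> z \in x :: map (@step_target T) p ->
  exists n, walk S z (drop n p) y /\
    suffix (z :: map (@step_target T) (drop n p)) (x :: map (@step_target T) p).
Proof.
elim: p x => [|s p IHp] x /=.
  by move=> -> /[1!inE]/eqP ->; exists 0%N; rewrite suffix_refl.
move=> [Ss sx wp]; rewrite inE => /orP[/eqP ->|/(IHp _ wp)[n [wn sn]]].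
  by exists 0%N; rewrite drop0 suffix_refl.
by exists n.+1; split=> //=; apply: suffix_trans sn _; exact: (suffix_suffix [:: x]).
Qed.

(** Closed detours are cut out: if the start recurs later, only the suffix found by [walk_suffix] is
    kept. *)
Lemma walk_shorten S x p y : walk S x p y ->
  exists q, [/\ walk S x q y, uniq (x :: map (@step_target T) q) &
    uniq (map fst q)].
Proof.
elim: p x => [|s p IHp] x; first by move=> /= ->; exists [::].
move=> [Ss sx /IHp[q [wq uq ue]]].
have [xq|xq] := boolP (x \in step_target s :: map (@step_target T) q).
  have [n [wn /suffixP[r er]]] := walk_suffix wq xq.
  exists (drop n q); split=> //.
    by move: uq; rewrite er cat_uniq => /and3P[].
  by rewrite map_drop drop_uniq.
exists (s :: q); split=> //; first by rewrite map_cons cons_uniq xq uq.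
(* If [q] used the edge of [s] again, in either direction, both of its ends would be vertices of
   [q], and [x] is one of them. *)
rewrite map_cons cons_uniq ue andbT; apply: contra xq => /mapP[t tq est].
rewrite -(walk_sources wq) -sx.
have ht : step_target t \in step_target s :: map (@step_target T) q.
  by rewrite inE map_f ?orbT.
have hs : step_source t \in step_target s :: map (@step_target T) q.
  by rewrite -(walk_sources wq) mem_rcons inE map_f ?orbT.
rewrite (walk_sources wq); move: hs ht; rewrite /step_source /step_target est.
by case: (s.2) (t.2) => [] [].
Qed.

(** A shortened walk from [x] to [y] avoiding the edge, preceded by that edge traversed backwards,
    would be a cycle based at [y]. *)
Lemma bridge_forest S x y : forest S -> S (x, y) ->
  ~ same_component (S `\ (x, y)) x y.
Proof.
move=> fS Sxy [p /walk_shorten[q [wq uq ue]]].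
apply: (fS (((x, y), false) :: q)); split=> //.
- exists y; split=> //; rewrite /step_target /=.
  by apply: walk_sub wq => e [].
- by move: uq; rewrite -(walk_sources wq) rcons_uniq /= => /andP[-> ->].
- rewrite /= ue andbT; apply/negP => /mapP[s sq es].
  by have [_] := walk_edges wq sq; rewrite -es; apply.
Qed.

End Walks.

(** * Spans of differences of a free family *)

Section FreeFamily.
Variables (F : fieldType) (E : lmodType F) (T : choiceType).
Implicit Types (f : T -> E) (S : set (T * T)).

(* Independence of the family [f]: every function on the index set extends to a
   linear form on the span of [f]. *)
Definition free_family f : Prop :=
  forall (I : eqType) (r : seq I) (c : I -> F) (u : I -> T),
    \sum_(i <- r) c i *: f (u i) = 0 ->
    forall phi : T -> F, \sum_(i <- r) c i * phi (u i) = 0.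

Definition differences f S : set E := [set f e.1 - f e.2 | e in S].

Lemma free_differences f : free_family f ->
  forall (I : eqType) (r : seq I) (c : I -> F) (e : I -> T * T),
    \sum_(i <- r) c i *: (f (e i).1 - f (e i).2) = 0 ->
    forall phi : T -> F, \sum_(i <- r) c i * (phi (e i).1 - phi (e i).2) = 0.
Proof.
move=> ff I r c e h phi.
(* Two copies of [I] index a combination of values of [f], the right copy carrying the minus
   signs. *)
pose c' (k : I + I) := match k with inl i => c i | inr i => - c i end.
pose u' (k : I + I) := match k with inl i => (e i).1 | inr i => (e i).2 end.
have := ff _ (map inl r ++ map inr r) c' u' _ phi.
rewrite !big_cat !big_map /= -!big_split /= => h'.
rewrite -[RHS]h'; first by apply: eq_bigr => i _; rewrite mulrBr mulNr.
by rewrite -[RHS]h; apply: eq_bigr => i _; rewrite scalerBr scaleNr.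
Qed.

(** The sign is -1 exactly for a step traversed backwards, so every term is [f] at the source minus
    [f] at the target. *)
Lemma walk_telescope f S x p y : walk S x p y ->
  \sum_(s <- p) (-1) ^+ (~~ s.2) *: (f s.1.1 - f s.1.2) = f x - f y.
Proof.
elim: p x => [|s p IHp] x /=; first by move=> ->; rewrite big_nil subrr.
move=> [_ <- /IHp h]; rewrite big_cons h -[RHS](subrKA (f (step_target s))).
congr (_ + _); rewrite /step_source /step_target.
by case: s.2; rewrite ?scale1r // scaleN1r opprB.
Qed.

Lemma walk_span f S x y :
  same_component S x y -> linear_span (differences f S) (f x - f y).
Proof.
move=> [p wp]; rewrite -(walk_telescope f wp) big_seq.
elim/big_ind: _ => [|v w|s sp]; [exact: linear_span0|exact: linear_spanD|].
by apply/linear_spanZ/sub_linear_span; exists s.1 => //; apply: walk_edges wp _ sp.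
Qed.

Lemma span_same_component f S x y : free_family f ->
  linear_span (differences f S) (f x - f y) <-> same_component S x y.
Proof.
move=> ff; split=> [[n [c [u [Au exy]]]]|]; last exact: walk_span.
have /choice[e he] i : exists e, S e /\ f e.1 - f e.2 = u i.
  by have [e Se <-] := Au i; exists e.
(* [phi] is constant along every edge of [S], and [phi x = 1]; the relation will force
   [phi y = 1]. *)
pose phi z : F := `[< same_component S x z >]%:R.
(* [None] carries [f x - f y] itself, so that the combination vanishes. *)
pose c' (k : option 'I_n) := if k is Some i then - c i else 1.
pose e' (k : option 'I_n) := if k is Some i then e i else (x, y).
have := free_differences ff (r := None :: map Some (index_enum 'I_n))
  (c := c') (e := e') _ phi.
rewrite !big_cons !big_map /= scale1r mul1r exy -big_split big1 => [|i _].
  move=> /(_ erefl); rewrite [X in _ + X]big1 => [|i _]; last first.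
    have Sei : S ((e i).1, (e i).2) by rewrite -surjective_pairing; exact: (he i).1.
    by rewrite /phi (asbool_equiv_eq (component_edge x Sei)) subrr mulr0.
  rewrite addr0 {1}/phi (asboolT (same_component_refl _ _)) /phi.
  by case: asboolP => // _ /eqP; rewrite subr0 oner_eq0.
by rewrite /= (he i).2 scaleNr subrr.
Qed.

End FreeFamily.

(** * Independence of differences and forests *)

Section Forest.
Variables (F : numFieldType) (E : lmodType F) (T : choiceType).
Implicit Types (f : T -> E) (S : set (T * T)).

(** The indicator of [a] is 1 on the left, which forces [x = a], as otherwise the right side is at
    most 0; dually for [b]. In particular [(a, b)] and [(b, a)] give distinct vectors. *)
Lemma free_difference_inj f a b x y : free_family f -> a != b ->
  f a - f b = f x - f y -> (a, b) = (x, y).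
Proof.
move=> ff ab eab.
have hphi (phi : T -> F) : phi a - phi b = phi x - phi y.
  have := free_differences ff (r := [:: (1, (a, b)); (-1, (x, y))])
    (c := fst) (e := snd) _ phi.
  rewrite !big_cons !big_nil /= !scale1r !scaleN1r !mul1r !mulN1r !addr0 eab.
  by rewrite subrr => /(_ erefl)/eqP; rewrite subr_eq0 => /eqP.
have ha := hphi (fun z => (z == a)%:R).
have hb := hphi (fun z => (z == b)%:R).
rewrite eqxx [b == a]eq_sym (negPf ab) subr0 in ha.
rewrite eqxx (negPf ab) sub0r in hb.
congr (_, _); apply/eqP; rewrite eq_sym; apply: contraT => /negPf ne.
  have : true%:R <= 0 :> F by rewrite ha ne sub0r oppr_le0 ler0n.
  by rewrite lern0.
have : 0 <= - true%:R :> F by rewrite hb ne subr0 ler0n.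
by rewrite oppr_ge0 lern0.
Qed.

Lemma forest_independent f S : free_family f ->
  linearly_independent (differences f S) <-> forest S.
Proof.
move=> ff; split=> [li p [pn0 [x wp] _ ue]|fS n c u uinj Au u0 i].
  (* Loops are split off: they all give the zero vector, which is dependent by itself, while
     [linearly_independent] wants distinct vectors. *)
  have lp := walk_edges wp; have [/hasP[s sp /eqP es]|nl] :=
    boolP (has (fun s : step T => s.1.1 == s.1.2) p).
    have : (1 : F) = 0.
      apply: (li 1%N (fun=> 1) (fun=> 0) _ _ _ ord0) => [i j _|_|].
      - by rewrite !ord1.
      - by exists s.1; [exact: lp|rewrite es subrr].
      - by rewrite big_ord1 scaler0.
    by apply/eqP/oner_neq0.
  case: p pn0 wp ue lp nl => // s p _ wp ue lp nl.
  (* Without loops, the distinct edges of the cycle give distinct vectors, whose telescoping sum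
     with coefficients 1 and -1 vanishes. *)
  pose t := in_tuple (s :: p).
  have : ((-1) ^+ (~~ (tnth t ord0).2) : F) = 0.
    apply: (li _ (fun i => (-1) ^+ (~~ (tnth t i).2))
      (fun i => f (tnth t i).1.1 - f (tnth t i).1.2)) => [i j eij|i|].
    - have ni : (tnth t i).1.1 != (tnth t i).1.2.
        by have /hasPn := nl; apply; apply: mem_tnth.
      have := free_difference_inj ff ni eij; rewrite -!surjective_pairing.
      rewrite !(tnth_nth s) => e.
      have := nth_uniq s.1 _ _ ue; rewrite size_map => /(_ i j (ltn_ord _) (ltn_ord _)).
      by rewrite !(nth_map s) ?ltn_ord // e eqxx => /esym/eqP/val_inj.
    - by exists (tnth t i).1 => //; apply/lp/mem_tnth.
    - rewrite -(big_tuple _ _ t predT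
        (fun s => (-1) ^+ (~~ s.2) *: (f s.1.1 - f s.1.2))).
      by rewrite (walk_telescope f wp) subrr.
  by apply/eqP; rewrite signr_eq0.
have /choice[e he] j : exists e, S e /\ f e.1 - f e.2 = u j.
  by have [e Se <-] := Au j; exists e.
(* As [u] is injective, the other edges [e j] survive the removal of [e i]. *)
have ne j : j != i -> e j <> e i.
  by move=> /eqP ji eji; apply/ji/uinj; rewrite -!(he _).2 eji.
pose phi z : F := `[< same_component (S `\ e i) (e i).1 z >]%:R.
have h := free_differences ff (r := index_enum 'I_n) (c := c) (e := e) _ phi.
have {h} : \sum_j c j * (phi (e j).1 - phi (e j).2) = 0.
  by apply: h; rewrite -[RHS]u0; apply: eq_bigr => j _; rewrite (he _).2.
rewrite (bigD1 i) //= [X in _ + X]big1 ?addr0 => [|j ji]; last first.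
  have Sej : (S `\ e i) ((e j).1, (e j).2).
    by rewrite -surjective_pairing; split; [exact: (he j).1|exact: ne].
  by rewrite /phi (asbool_equiv_eq (component_edge (e i).1 Sej)) subrr mulr0.
rewrite /phi (asboolT (same_component_refl _ _)) asboolF ?subr0 ?mulr1 //.
have := (he i).1; case: (e i) => x y /= Sxy xy.
by case: (bridge_forest fS Sxy).
Qed.

End Forest.

(** * Freeness from triangularity *)

Section Triangular.
Variables (F : fieldType) (X : Type) (T : choiceType).

(** Evaluated at [pt K], a relation involves only [K] and indices of smaller rank; strong induction
    on the rank disposes of the latter. *)
Lemma triangular_free (f : T -> X -> F^o) (pt : T -> X) (rk : T -> nat) :
  (forall K, f K (pt K) != 0) ->
  (forall L K, f L (pt K) != 0 -> L != K -> (rk L < rk K)%N) ->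
  free_family (f : T -> (X -> F^o)).
Proof.
move=> f_diag f_tri I r c u rel phi.
(* [u] may repeat values, so the coefficients of equal indices are added up first. *)
pose d K := \sum_(i <- r | u i == K) c i.
have group (psi : T -> F) :
    \sum_(i <- r) c i * psi (u i) = \sum_(K <- undup (map u r)) d K * psi K.
  under [RHS]eq_bigr => K _ do rewrite /d mulr_suml big_mkcond.
  rewrite exchange_big /=; apply: eq_big_seq => i ir.
  have ui : u i \in undup (map u r) by rewrite mem_undup map_f.
  rewrite (bigD1_seq (u i)) ?undup_uniq //= eqxx big1 ?addr0 // => K.
  by rewrite eq_sym => /negPf ->.
suff d0 K : d K = 0 by rewrite group big1 // => K _; rewrite d0 mul0r.
elim/ltn_ind: (rk K) {-2}K (erefl (rk K)) => n IHn {}K rK.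
have [Kr|Kr] := boolP (K \in undup (map u r)); last first.
  rewrite /d big1_seq // => i /andP[/eqP uiK ir].
  by rewrite -uiK mem_undup map_f in Kr.
have := congr1 (fun g => g (pt K)) rel; rewrite fct_sumE /=.
rewrite (group (fun L => f L (pt K))) (bigD1_seq K) ?undup_uniq //=.
rewrite big1 ?addr0 => [/eqP|L LK].
  by rewrite mulf_eq0 (negPf (f_diag K)) orbF => /eqP.
have [->|fL] := eqVneq (f L (pt K)) 0; first by rewrite mulr0.
by rewrite (IHn (rk L)) ?mul0r // -rK f_tri.
Qed.

End Triangular.

(** * Independence of the fundamental quasisymmetric functions *)

Section Fundamental.
Implicit Types J K L : composition.

Lemma sumn_takeS (s : seq nat) i :
  (i < size s)%N -> sumn (take i.+1 s) = (sumn (take i s) + nth 0 s i)%N.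
Proof. by move=> ltis; rewrite (take_nth 0%N) // sumn_rcons. Qed.

Lemma sumn_take_lt L i k :
  (i < k)%N -> (k <= size L)%N -> (sumn (take i L) < sumn (take k L))%N.
Proof.
have posL := allP (valP L); elim: k => // k IHk ik kL.
rewrite sumn_takeS // -addn1 leq_add //; last exact/posL/mem_nth.
by move: ik; rewrite ltnS leq_eqVlt => /orP[/eqP -> //|/IHk/(_ (ltnW kL))/ltnW].
Qed.

Lemma size_Des L : size (Des L) = (size L).-1.
Proof. by rewrite size_map size_iota. Qed.

Lemma Des_bounds L j : j \in Des L -> (0 < j < weight L)%N.
Proof.
case/mapP => i; rewrite mem_iota => /andP[i0 iL] ->.
have {}iL : (i < size L)%N by case: (size L) iL => // /(leq_trans i0).
have := sumn_take_lt i0 (ltnW iL); rewrite take0 => -> /=.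
by have := sumn_take_lt iL (leqnn _); rewrite take_size.
Qed.

Lemma Des_sorted L : sorted ltn (Des L).
Proof.
apply: (homo_sorted_in (P := mem (iota 1 (size L).-1))); last exact: iota_ltn_sorted.
  move=> i k _; rewrite mem_iota => /andP[_ kL] ik.
  by apply: sumn_take_lt ik _; case: (size L) kL => // n /ltnW.
by apply/allP.
Qed.

Lemma nth_Des L i : (i.+1 < size L)%N -> nth 0%N (Des L) i = sumn (take i.+1 L).
Proof.
move=> iL; have {}iL : (i < (size L).-1)%N by case: (size L) iL.
by rewrite (nth_map 0%N) ?size_iota // nth_iota // add1n.
Qed.

Lemma weight_gt0 L : (0 < weight L)%N = (0 < size L)%N.
Proof.
apply/idP/idP => [|L0]; first by rewrite /weight; case: (parts L).
by have := sumn_take_lt L0 (leqnn _); rewrite take0 take_size.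
Qed.

(** [Des] omits the total from the partial sums and the weight restores it; the parts are
    differences of consecutive partial sums. *)
Lemma Des_inj J K : weight J = weight K -> Des J = Des K -> J = K.
Proof.
(* [Des] is empty both for no part and for one part; the weight separates these cases. *)
move=> eW eD; have eS : size J = size K.
  have := congr1 size eD; rewrite !size_Des.
  have := weight_gt0 J; rewrite eW weight_gt0.
  by case: (size J) (size K) => [|m] [|n] //= _ ->.
have et i : (i <= size J)%N -> sumn (take i J) = sumn (take i K).
  case: i => [|i]; first by rewrite !take0.
  rewrite leq_eqVlt => /orP[/eqP ->|iJ]; last by rewrite -!nth_Des -?eS // eD.
  by rewrite {2}eS !take_size.
apply/val_inj/(eq_from_nth (x0 := 0%N)) => // i iJ.
apply: (@addnI (sumn (take i J))); rewrite -sumn_takeS //.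
by rewrite et // et 1?ltnW // sumn_takeS -?eS.
Qed.

(** For parts j_1, ..., j_m this is the word of j_1 letters 1, then j_2 letters 2, up to j_m letters
    m. *)
Definition Des_word K : seq nat :=
  mkseq (fun p => (count (fun j => j <= p)%N (Des K)).+1) (weight K).

Lemma Des_word_ascent K j : (0 < j < weight K)%N ->
  (nth 0 (Des_word K) j.-1 < nth 0 (Des_word K) j)%N = (j \in Des K).
Proof.
case: j => // j /andP[_ jK]; rewrite !nth_mkseq //= ?(ltnW jK) // ltnS.
(* The two letters differ by the multiplicity of [j.+1] in [Des K], which is 0 or 1. *)
have -> : count (fun k => k <= j.+1)%N (Des K) =
    (count (fun k => k <= j)%N (Des K) + count_mem j.+1 (Des K))%N.
  elim: (Des K) => //= k s ->; rewrite addnACA; congr (_ + _)%N.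
  rewrite leq_eqVlt ltnS; have [->|_] := eqVneq k j.+1; last by rewrite addn0.
  by rewrite ltnn.
rewrite -[ltnLHS]addn0 ltn_add2l count_uniq_mem ?lt0b //.
exact: sorted_uniq ltn_trans ltnn _ (Des_sorted K).
Qed.

Lemma Des_word_sorted K : sorted leq (Des_word K).
Proof.
apply: (homo_sorted (e := leq)); last exact: iota_sorted.
by move=> p q pq; rewrite ltnS; apply: sub_count => j /leq_trans; apply.
Qed.

Lemma fundamental_word_Des_word L K : fundamental_word L (Des_word K) ->
  weight K = weight L /\ {subset Des L <= Des K}.
Proof.
case/and4P; rewrite size_mkseq => /eqP eW _ _ /allP DL; split=> // j jL.
by rewrite -Des_word_ascent; [exact: DL|rewrite eW; exact: Des_bounds].
Qed.

Lemma fundamental_word_Des_word_refl K : fundamental_word K (Des_word K).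
Proof.
rewrite /fundamental_word size_mkseq eqxx Des_word_sorted /=; apply/andP; split.
  by apply/allP => _ /mapP[p _ ->].
by apply/allP => j jK; rewrite Des_word_ascent // Des_bounds.
Qed.

(** A monomial has a single weakly increasing arrangement, so only [w] can contribute to this
    coefficient. *)
Lemma fundamental_seq_mset L w : sorted leq w ->
  fundamental L (seq_mset w) = (fundamental_word L w)%:R.
Proof.
move=> sw; rewrite /fundamental.
have [Lw|nLw] := boolP (fundamental_word L w).
  rewrite -(@fsbig_widen _ _ _ _ [set w]) /=.
  - by rewrite fsbig_set1 eqxx.
  - by move=> _ ->.
  - move=> v [Lv vw] /=; case: eqP => // /eq_seq_msetP wv; case: vw.
    apply/esym; apply: (sorted_eq leq_trans anti_leq sw _ wv).
    by case/and4P: Lv.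
rewrite fsbig1 // => v Lv; case: eqP => // /eq_seq_msetP wv.
case/negP: nLw; rewrite (sorted_eq leq_trans anti_leq sw _ wv) //.
by case/and4P: Lv.
Qed.

Lemma fundamental_free : free_family fundamental.
Proof.
apply: (triangular_free (pt := fun K => seq_mset (Des_word K))
  (rk := fun K => size (Des K))) => [K|L K].
  by rewrite fundamental_seq_mset ?Des_word_sorted // fundamental_word_Des_word_refl.
rewrite fundamental_seq_mset ?Des_word_sorted //.
case: (boolP (fundamental_word _ _)) => [/fundamental_word_Des_word[eW sD]|]; last first.
  by rewrite eqxx.
move=> _ nLK; have uD M := sorted_uniq ltn_trans ltnn (Des_sorted M).
(* If the sizes agreed, the inclusion would make the sorted lists [Des L] and [Des K] equal, against
   [nLK]. *)
rewrite ltn_neqAle (uniq_leq_size (uD L) sD) andbT; apply: contra nLK => /eqP eS.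
apply/eqP/Des_inj => //; apply: (irr_sorted_eq ltn_trans ltnn); try exact: Des_sorted.
by have [] := uniq_min_size (uD L) sD _; rewrite ?eS.
Qed.

End Fundamental.

(** * Components and equivalence classes of the statistic *)

Lemma st_equiv_component (V : Type) (st : permutation -> V)
    (S : set (composition * composition)) J K :
  (forall J K, S (J, K) -> st_equiv st J K) ->
  same_component S J K -> st_equiv st J K.
Proof.
move=> hS [p]; elim: p J => [|s p IHp] J /=; first by move=> ->.
move=> [+ <- /IHp[eV eW]]; rewrite (surjective_pairing s.1) => /hS[e1 e2].
rewrite /st_equiv -{}eV -{}eW /step_source /step_target.
by case: s.2; split.
Qed.

Theorem theorem1 (V : Type) (st : permutation -> V)
    (S : set (composition * composition))
    (hst : descent_statistic st)
    (hS : forall J K : composition, S (J, K) -> st_equiv st J K) :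
  (linear_span (fundamental_differences S) = kernel st <->
     forall J K : composition, st_equiv st J K <-> same_component S J K) /\
  (linearly_independent (fundamental_differences S) <-> forest S).
Proof.
split; last exact: forest_independent fundamental_free.
split=> [eS J K|hC].
  split=> [JK|]; last exact: st_equiv_component.
  apply/(span_same_component _ _ _ fundamental_free); rewrite /differences.
  rewrite -[X in linear_span X]/(fundamental_differences S) eS.
  by apply: sub_linear_span; exists (J, K).
(* Each span contains the generators of the other: one way by [hS], the other by telescoping along
   walks. *)
apply/seteqP; split; apply: linear_span_min => _ [[J K] /= JK <-].
  by apply: sub_linear_span; exists (J, K) => //; apply: hS.
by apply/walk_span/hC.
Qed.
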